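(* Fix an element $a$ in a right heap $(H,[-,-,-])$. Then: (1) The mapping $p_a\colon H\to H$, defined by $p_a(x)=[x,a,a]$ for every $x\in H$, is an idempotent endomorphism of the right heap $H$. The image $G_a$ of $p_a$ is a right subheap of $H$ and is a heap. (2) The mapping $q_a\colon H\to H$, defined by $q_a(x)=[a,x,x]$ for every $x\in H$, is an idempotent endomorphism of the right heap $H$. The image $E_a$ of $q_a$ is a right subheap of $H$ and is a right zero heap. (3) $x=[p_a(x),a,q_a(x)]$ for every $x\in H$. (4) $H$ is isomorphic to the direct product of the heap $G_a$ and the right zero heap $E_a$. The isomorphism is $\nu_a\colon H\to G_a\times E_a$, $x\mapsto([x,a,a],[a,x,x])$. Its inverse is the mapping $\mu_a\colon G_a\times E_a\to H$, $(y,z)\mapsto[y,a,z]$. (5) $G_a\cap E_a=\{a\}$. (6) For every $x\in H$, $x=[p_a(x),a,q_a(x)]$ is the unique way of writing $x$ in the form $x=[y,a,z]$ with $y$ in the heap $G_a$ and $z$ in the right zero heap $E_a$. (7) The two idempotent endomorphisms $p_a,q_a\colon H\to H$ are mutually orthogonal, in the sense that $p_a\circ q_a=q_a\circ p_a$ is the constant morphism $H\to H$ that sends all elements of $H$ to $a$. (8) The kernels of $p_a$ and $q_a$ are the congruences $\sim$ and $\equiv$, respectively, where $\sim$ is the congruence on the right heap $H$ generated by the set $\{([x,y,y],x)\mid x,y\in H\}$ and $\equiv$ is the congruence on the right heap $H$ generated by the set $\{([x,y,z],z)\mid x,y,z\in H\}$.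
   Context: A right heap is a pair $(H,[-,-,-])$, where $H$ is a set and $[-,-,-]\colon H\times H\times H\to H$ is a ternary operation which is associative ($[[x,y,z],w,u]=[x,y,[z,w,u]]$), left Mal'tsev ($[x,x,y]=y$) and right weakly Mal'tsev ($[x,y,[y,z,w]]=[x,z,w]$), for all $x,y,z,w,u\in H$. Morphisms of right heaps are the mappings preserving the ternary operation. A right subheap is a subset closed under the ternary operation. A heap is a set with an associative ternary operation that is Mal'tsev, i.e. $[x,x,y]=y$ and $[x,y,y]=x$ for all $x,y$. A right zero heap is a right heap whose ternary operation is the third projection, i.e. $[x,y,z]=z$ for all $x,y,z$. A congruence on a right heap is an equivalence relation compatible with the ternary operation. The kernel of a mapping $f\colon H\to H$ is the equivalence relation $\{(x,y)\in H\times H\mid f(x)=f(y)\}$. Direct products have componentwise operation. *)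

(* Defs.v *)
From HB Require Import structures.
From mathcomp Require Import all_boot.
From mathcomp Require Import boolp classical_sets functions.

Set Implicit Arguments.
Unset Strict Implicit.
#[export] Unset Printing Implicit Defensive.

Local Open Scope classical_set_scope.

Section TernaryLaws.
Variables (T : Type) (op : T -> T -> T -> T).

Definition ternary_assoc :=
  forall x y z w u, op (op x y z) w u = op x y (op z w u).
Definition left_maltsev := forall x y, op x x y = y.
Definition right_maltsev := forall x y, op x y y = x.
Definition right_weakly_maltsev :=
  forall x y z w, op x y (op y z w) = op x z w.

Definition is_heap := [/\ ternary_assoc, left_maltsev & right_maltsev].

End TernaryLaws.

HB.mixin Record isRightHeap H := {
  hop : H -> H -> H -> H;
  hop_assoc : ternary_assoc hop;
  hop_left_maltsev : left_maltsev hop;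
  hop_right_weakly_maltsev : right_weakly_maltsev hop
}.

#[short(type="rightHeapType")]
HB.structure Definition RightHeap := { H of isRightHeap H }.

Declare Scope heap_scope.
Delimit Scope heap_scope with heap.
Notation "[ x , y , z ]" := (hop x y z)
  (at level 0, format "[ x ,  y ,  z ]") : heap_scope.
Local Open Scope heap_scope.

Definition right_heap_morphism (H K : rightHeapType) (f : H -> K) :=
  forall x y z : H, f [x, y, z] = [f x, f y, f z].

Definition right_heap_isomorphism (H K : rightHeapType) (f : H -> K) :=
  right_heap_morphism f /\ bijective f.

Definition is_right_zero_heap (H : rightHeapType) :=
  forall x y z : H, [x, y, z] = z.

Definition right_subheap (H : rightHeapType) (S : set H) :=
  forall x y z : H, S x -> S y -> S z -> S [x, y, z].

Section Subheap.
Variables (H : rightHeapType) (S : set H) (hS : right_subheap S).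

Definition subheap_type of right_subheap S : Type := set_type S.
Local Notation sub := (subheap_type hS).

Definition sub_hop (x y z : sub) : sub :=
  SigSub (mem_set (hS (set_mem (valP x)) (set_mem (valP y))
                      (set_mem (valP z)))).

Fact sub_hop_assoc : ternary_assoc sub_hop.
Proof. by move=> x y z w u; apply: val_inj; apply: hop_assoc. Qed.

Fact sub_hop_left_maltsev : left_maltsev sub_hop.
Proof. by move=> x y; apply: val_inj; apply: hop_left_maltsev. Qed.

Fact sub_hop_right_weakly_maltsev : right_weakly_maltsev sub_hop.
Proof. by move=> x y z w; apply: val_inj; apply: hop_right_weakly_maltsev. Qed.

HB.instance Definition _ := isRightHeap.Build sub
  sub_hop_assoc sub_hop_left_maltsev sub_hop_right_weakly_maltsev.

End Subheap.

Section Product.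
Variables H K : rightHeapType.

Definition prod_hop (x y z : H * K) : H * K :=
  ([x.1, y.1, z.1], [x.2, y.2, z.2]).

Fact prod_hop_assoc : ternary_assoc prod_hop.
Proof. by move=> x y z w u; congr pair; apply: hop_assoc. Qed.

Fact prod_hop_left_maltsev : left_maltsev prod_hop.
Proof. by move=> x [y1 y2]; congr pair; apply: hop_left_maltsev. Qed.

Fact prod_hop_right_weakly_maltsev : right_weakly_maltsev prod_hop.
Proof. by move=> x y z w; congr pair; apply: hop_right_weakly_maltsev. Qed.

HB.instance Definition _ := isRightHeap.Build (H * K)%type
  prod_hop_assoc prod_hop_left_maltsev prod_hop_right_weakly_maltsev.

End Product.

Record is_congruence (H : rightHeapType) (R : set (H * H)) : Prop := IsCongruence {
  congruence_refl : forall x, R (x, x);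
  congruence_sym : forall x y, R (x, y) -> R (y, x);
  congruence_trans : forall x y z, R (x, y) -> R (y, z) -> R (x, z);
  congruence_hop : forall x x' y y' z z',
    R (x, x') -> R (y, y') -> R (z, z') -> R ([x, y, z], [x', y', z'])
}.

Definition generated_congruence (H : rightHeapType) (X : set (H * H)) :
  set (H * H) := smallest (@is_congruence H) X.

Definition map_kernel (H : Type) (f : H -> H) : set (H * H) :=
  [set xy | f xy.1 = f xy.2].

Section Decomposition.
Variables (H : rightHeapType) (a : H).

Definition pendo (x : H) : H := [x, a, a].
Definition qendo (x : H) : H := [a, x, x].

Definition Gset : set H := range pendo.
Definition Eset : set H := range qendo.

Variables (hG : right_subheap Gset) (hE : right_subheap Eset).

Definition numap (x : H) : subheap_type hG * subheap_type hE :=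
  (SigSub (mem_set (imageT pendo x)), SigSub (mem_set (imageT qendo x))).

Definition mumap (yz : subheap_type hG * subheap_type hE) : H :=
  [val yz.1, a, val yz.2].

End Decomposition.

Arguments numap {H a} hG hE x.
Arguments mumap {H a} hG hE yz.

(* Main.v *)
Require Import Defs.
From mathcomp Require Import all_boot.
From mathcomp Require Import boolp classical_sets functions.

Local Open Scope classical_set_scope.
Local Open Scope heap_scope.

(** Everything comes from reading the map [[x, y, -]] of [H] to itself as a
fraction [x/y]. The left Mal'tsev law says that [x/x] is the identity, the
right weak Mal'tsev law that [(x/y)(y/z) = x/z], and associativity that
[(x/y)(z/w) = [x, y, z]/w]. In particular [x/y] and [y/x] are mutually inverse
bijections. What may fail in a right heap is that [x/y] sends [y] to [x].

Two consequences carry the proof. The fraction [x/y] does not change when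
[x] or [y] is replaced by [[x, b, b]] or [[y, b, b]] ([hop_fold_left],
[hop_fold_mid]); so [p_a x = [x, a, a]] forgets exactly the defect
[[x, y, y] <> x] of being a heap. On the other side, a denominator of the form
[[x, y, z]] unfolds ([hop_unfold_mid]), so that [q_a [x, y, z] = q_a z]
([qendo_hop]): [q_a] forgets everything but the right zero part.

Since [[p_a x, a, q_a x] = x], the pair [(p_a x, q_a x)] determines [x], and
[p_a] and [q_a] read off [y] and [z] from [[y, a, z]] for [y] in [G_a] and [z]
in [E_a]; this gives the direct decomposition and its uniqueness. As for the
kernels, [x] is related to [p_a x] (respectively [q_a x]) by a generating
pair, so a congruence containing the generators identifies any two elements
with the same image. *)

Section Brackets.
Variable H : rightHeapType.
Implicit Types x y z u v w b : H.

(** Here [[x, b, b]/u = (x/b)(b/u) = x/u]. *)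
Lemma hop_fold_left x b u v : [[x, b, b], u, v] = [x, u, v].
Proof. by rewrite hop_assoc hop_right_weakly_maltsev. Qed.

(** By [hop_fold_left], the fraction [y/[y, b, b]] is the identity; the right
weak Mal'tsev law inserts it after [u/y]. *)
Lemma hop_fold_mid u y b v : [u, [y, b, b], v] = [u, y, v].
Proof.
rewrite -(hop_right_weakly_maltsev u y [y, b, b] v).
by rewrite -(hop_fold_left y b [y, b, b]) hop_left_maltsev.
Qed.

(** As [[x, y, z]/z = (x/y)(z/z) = x/y], the inverse [z/[x, y, z]] is [y/x];
composing it with [u/z] gives [u/[x, y, z]]. *)
Lemma hop_unfold_mid u x y z w : [u, [x, y, z], w] = [u, z, [y, x, w]].
Proof.
have -> : [y, x, w] = [z, [x, y, z], w].
  rewrite -[in LHS](hop_left_maltsev [x, y, z] w) -hop_assoc.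
  by rewrite hop_right_weakly_maltsev hop_left_maltsev.
by rewrite hop_right_weakly_maltsev.
Qed.

Lemma kernel_congruence (f : H -> H) :
  right_heap_morphism f -> is_congruence (map_kernel f).
Proof.
move=> fM; split; rewrite /map_kernel /=.
- by [].
- by move=> x y ->.
- by move=> x y z -> ->.
- by move=> x x' y y' z z' xx' yy' zz'; rewrite !fM xx' yy' zz'.
Qed.

(** The pairs [(f x, x)] in [X] link two elements with the same image through
that image. *)
Lemma kernel_generated (f : H -> H) (X : set (H * H)) :
  right_heap_morphism f -> X `<=` map_kernel f -> (forall x, X (f x, x)) ->
  map_kernel f = generated_congruence X.
Proof.
move=> fM Xf fX; apply/seteqP; split; last first.
  by apply: smallest_sub => //; apply: kernel_congruence.
move=> [x y] /= fxy R [Rcong XR].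
apply: (congruence_trans Rcong (y := f x)).
  exact/(congruence_sym Rcong)/XR/fX.
by rewrite [f x]fxy; apply/XR/fX.
Qed.

End Brackets.

Section Projections.
Variables (H : rightHeapType) (a : H).
Implicit Types x y z : H.

Lemma pendo_hop x y z : pendo a [x, y, z] = [x, y, pendo a z].
Proof. exact: hop_assoc. Qed.

Lemma qendo_hop x y z : qendo a [x, y, z] = qendo a z.
Proof.
by rewrite /qendo hop_unfold_mid hop_right_weakly_maltsev hop_left_maltsev.
Qed.

Lemma pendo_morphism : right_heap_morphism (pendo a).
Proof.
by move=> x y z; rewrite pendo_hop /pendo hop_fold_left hop_fold_mid.
Qed.

Lemma qendo_zero x y z : [qendo a x, qendo a y, z] = z.
Proof. by rewrite hop_fold_left hop_fold_mid hop_left_maltsev. Qed.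

Lemma qendo_morphism : right_heap_morphism (qendo a).
Proof. by move=> x y z; rewrite qendo_hop qendo_zero. Qed.

Lemma pendo_base : pendo a a = a. Proof. exact: hop_left_maltsev. Qed.

Lemma qendo_base : qendo a a = a. Proof. exact: hop_left_maltsev. Qed.

Lemma pendo_idem x : pendo a (pendo a x) = pendo a x.
Proof. exact: hop_fold_left. Qed.

Lemma qendo_idem x : qendo a (qendo a x) = qendo a x.
Proof. exact: qendo_hop. Qed.

Lemma pendo_qendo x : pendo a (qendo a x) = a.
Proof. by rewrite /pendo hop_fold_left hop_left_maltsev. Qed.

Lemma qendo_pendo x : qendo a (pendo a x) = a.
Proof. by rewrite qendo_hop qendo_base. Qed.

Lemma pendo_fold x y : pendo a [x, y, y] = pendo a x.
Proof. exact: hop_fold_left. Qed.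

Lemma pendo_qendo_decomposition x : [pendo a x, a, qendo a x] = x.
Proof. by rewrite hop_fold_left hop_right_weakly_maltsev hop_left_maltsev. Qed.

Lemma Gset_fixed y : Gset a y -> pendo a y = y.
Proof. by case=> x _ <-; apply: pendo_idem. Qed.

Lemma Eset_fixed z : Eset a z -> qendo a z = z.
Proof. by case=> x _ <-; apply: qendo_idem. Qed.

Lemma pendo_compose y z : Gset a y -> Eset a z -> pendo a [y, a, z] = y.
Proof.
by move=> Gy /Eset_fixed <-; rewrite pendo_hop pendo_qendo; apply: Gset_fixed.
Qed.

Lemma qendo_compose y z : Eset a z -> qendo a [y, a, z] = z.
Proof. by move=> Ez; rewrite qendo_hop Eset_fixed. Qed.

Lemma Gset_subheap : right_subheap (Gset a).
Proof.
move=> _ _ _ [x _ <-] [y _ <-] [z _ <-].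
by rewrite -pendo_morphism; apply: imageT.
Qed.

Lemma Eset_subheap : right_subheap (Eset a).
Proof.
move=> _ _ _ [x _ <-] [y _ <-] [z _ <-].
by rewrite -qendo_morphism; apply: imageT.
Qed.

Variables (hG : right_subheap (Gset a)) (hE : right_subheap (Eset a)).

(** In [G_a] the bracket [[x, y, y]] equals its own image under [p_a], which
is that of [x]. *)
Lemma Gset_heap : is_heap (@hop (subheap_type hG)).
Proof.
split; [exact: hop_assoc | exact: hop_left_maltsev |].
move=> x y; apply: val_inj.
have Gx : Gset a (val x) := set_mem (valP x).
have Gy : Gset a (val y) := set_mem (valP y).
rewrite -[RHS](Gset_fixed _ Gx) -(pendo_fold (val x) (val y)).
by rewrite Gset_fixed //; apply: hG.
Qed.

Lemma Eset_right_zero : is_right_zero_heap (subheap_type hE).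
Proof.
move=> x y z; apply: val_inj => /=.
rewrite -[val x](Eset_fixed _ (set_mem (valP x))).
by rewrite -[val y](Eset_fixed _ (set_mem (valP y))) qendo_zero.
Qed.

Lemma numap_morphism : right_heap_morphism (numap hG hE).
Proof.
move=> x y z; congr pair; apply: val_inj.
  exact: pendo_morphism.
exact: qendo_morphism.
Qed.

Lemma numapK : cancel (numap hG hE) (mumap hG hE).
Proof. exact: pendo_qendo_decomposition. Qed.

Lemma mumapK : cancel (mumap hG hE) (numap hG hE).
Proof.
move=> [y z]; have Gy := set_mem (valP y); have Ez := set_mem (valP z).
congr pair; apply: val_inj; first exact: pendo_compose.
exact: qendo_compose.
Qed.

End Projections.

Theorem proposition2p11 (H : rightHeapType) (a : H) :
  exists (hG : right_subheap (Gset a)) (hE : right_subheap (Eset a)),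
  (* (1) *)
  (right_heap_morphism (pendo a) /\ idempotent_fun (pendo a) /\
   is_heap (@hop (subheap_type hG))) /\
  (* (2) *)
  (right_heap_morphism (qendo a) /\ idempotent_fun (qendo a) /\
   is_right_zero_heap (subheap_type hE)) /\
  (* (3) *)
  (forall x, x = [pendo a x, a, qendo a x]) /\
  (* (4) *)
  (right_heap_isomorphism (numap hG hE) /\
   cancel (numap hG hE) (mumap hG hE) /\
   cancel (mumap hG hE) (numap hG hE)) /\
  (* (5) *)
  Gset a `&` Eset a = [set a] /\
  (* (6) *)
  (forall x, unique
     (fun yz : H * H => [/\ Gset a yz.1, Eset a yz.2 & x = [yz.1, a, yz.2]])
     (pendo a x, qendo a x)) /\
  (* (7) *)
  (pendo a \o qendo a = cst a /\ qendo a \o pendo a = cst a /\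
   right_heap_morphism (cst a : H -> H)) /\
  (* (8) *)
  (map_kernel (pendo a) =
     generated_congruence [set u | exists x y, u = ([x, y, y], x)] /\
   map_kernel (qendo a) =
     generated_congruence [set u | exists x y z, u = ([x, y, z], z)]).
Proof.
have nuK := @numapK H a (@Gset_subheap H a) (@Eset_subheap H a).
have muK := @mumapK H a (@Gset_subheap H a) (@Eset_subheap H a).
have pM := @pendo_morphism H a; have qM := @qendo_morphism H a.
exists (@Gset_subheap H a), (@Eset_subheap H a).
split.
  by split=> //; split; [exact: pendo_idem | exact: Gset_heap].
split.
  by split=> //; split; [exact: qendo_idem | exact: Eset_right_zero].
split; first by move=> x; rewrite pendo_qendo_decomposition.
split.
  split=> //; split; first exact: numap_morphism.
  by exists (mumap (@Gset_subheap H a) (@Eset_subheap H a)).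
split.
  apply/seteqP; split=> [x [Gx Ex] | x ->] /=.
    by rewrite -(Gset_fixed _ _ x Gx) -(Eset_fixed _ _ x Ex) pendo_qendo.
  by split; exists a; rewrite ?pendo_base ?qendo_base.
split.
  move=> x; split.
    by split; [exact: imageT | exact: imageT | rewrite pendo_qendo_decomposition].
  by move=> [y z] [/= Gy Ez ->]; rewrite pendo_compose ?qendo_compose.
split.
  split; first exact/funext/pendo_qendo.
  split; first exact/funext/qendo_pendo.
  by move=> x y z; rewrite /cst hop_left_maltsev.
split; apply: kernel_generated => //.
- by move=> _ [x [y ->]]; apply: pendo_fold.
- by move=> x; exists x, a.
- by move=> _ [x [y [z ->]]]; apply: qendo_hop.
- by move=> x; exists a, x, x.
Qed.
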